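(* Let $M$ be a closed oriented manifold of odd dimension $d=2r-1$ and let $E\to M$ be a complex vector bundle with a flat connection $\nabla$. Let $\tau_\nabla$ be the quadratic form on $\mathrm{Det}(H^\bullet(M,E))$ determined by $\tau_\nabla(\rho_{\mathrm{an}}(\nabla))=e^{-2\pi i(\eta(\nabla)-\mathrm{rank}\,E\cdot\eta_{\mathrm{trivial}})}$. If $H^\bullet(M,E)=0$, so that $\mathrm{Det}(H^\bullet(M,E))$ is canonically $\mathbb{C}$ and both $\rho_{\mathrm{an}}(\nabla)$ and $\tau_\nabla$ (identified with its value at $1\in\mathbb{C}$) are non-zero complex numbers, then $$\tau_\nabla=\Big(\rho_{\mathrm{an}}(\nabla)\cdot e^{\pi i\left(\eta(\nabla)-\mathrm{rank}\,E\cdot\eta_{\mathrm{trivial}}\right)}\Big)^{-2}.$$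
   Context: **Determinant lines.** For a complex vector space $V$ with $\dim V=n$, $\mathrm{Det}(V)=\Lambda^nV$ ($\mathrm{Det}(0)=\mathbb{C}$), and $\mathrm{Det}(V)^{-1}$ is the dual line; for $0\ne c\in\mathrm{Det}(V)$, $c^{-1}$ is the dual element with $c^{-1}(c)=1$. For a complex $(C^\bullet,\partial)$, $0\to C^0\to\dots\to C^d\to0$, of finite dimensional spaces, $\mathrm{Det}(C^\bullet)=\bigotimes_j\mathrm{Det}(C^j)^{(-1)^j}$ and $\mathrm{Det}(H^\bullet(\partial))=\bigotimes_j\mathrm{Det}(H^j(\partial))^{(-1)^j}$. The canonical isomorphism $\phi_{C^\bullet}:\mathrm{Det}(C^\bullet)\to\mathrm{Det}(H^\bullet(\partial))$ is: write $C^j=B^j\oplus H^j\oplus A^j$ with $B^j=\partial C^{j-1}$, $B^j\oplus H^j=\ker\partial$, $\partial:A^j\cong B^{j+1}$; if $c_j=\partial x_{j-1}\wedge h_j\wedge x_j$ with $0\neq x_j\in\mathrm{Det}(A^j)$, $h_j\in\mathrm{Det}(H^j)\cong\mathrm{Det}(H^j(\partial))$, then $\phi_{C^\bullet}(c_0\otimes c_1^{-1}\otimes c_2\otimes\cdots)=(-1)^{N}h_0\otimes h_1^{-1}\otimes h_2\otimes\cdots$, $N=\frac12\sum_j\dim A^j(\dim A^j+(-1)^{j+1})$. A quadratic form on a line $L$ is a function $\tau:L\to\mathbb{C}$ with $\tau(zh)=z^2\tau(h)$. **Refined torsion (finite dimensional).** Let $d=2r-1$ and let $\Gamma:C^\bullet\to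 C^\bullet$ be a chirality operator: $\Gamma^2=1$, $\Gamma(C^j)=C^{d-j}$. For non-zero $c_j\in\mathrm{Det}(C^j)$, $0\le j\le r-1$, put $c_\Gamma=(-1)^{\mathcal R}c_0\otimes c_1^{-1}\otimes\cdots\otimes c_{r-1}^{(-1)^{r-1}}\otimes(\Gamma c_{r-1})^{(-1)^r}\otimes(\Gamma c_{r-2})^{(-1)^{r-1}}\otimes\cdots\otimes(\Gamma c_0)^{-1}\in\mathrm{Det}(C^\bullet)$, with $\mathcal R=\frac12\sum_{j=0}^{r-1}\dim C^j(\dim C^j+(-1)^{r+j})$. It is independent of the $c_j$, and $\rho_\Gamma:=\phi_{C^\bullet}(c_\Gamma)$. **Odd signature operator.** Fix a Riemannian metric $g^M$. $\nabla$ also denotes the covariant differential on $\Omega^\bullet(M,E)$. Let $\Gamma\omega=i^r(-1)^{k(k+1)/2}*\omega$ for $\omega\in\Omega^k(M,E)$ (so $\Gamma^2=1$), $\mathcal B=\Gamma\nabla+\nabla\Gamma$, and $\mathcal B_{\mathrm{even}}$ its restriction to even-degree forms. For an interval $\mathcal I\subset[0,\infty)$, $\Omega^\bullet_{\mathcal I}(M,E)$ is the image of the spectral projection of $\mathcal B^2$ onto eigenvalues with absolute value in $\mathcal I$; it is a $\nabla$- and $\Gamma$-invariant subcomplex, finite dimensional for bounded $\mathcal I$. If $0\notin\mathcal I$, $\Omega^k_{\mathcal I}=\Omega^k_{+,\mathcal I}\oplus\Omega^k_{-,\mathcal I}$ with $\Omega^k_{+,\mathcal I}=\ker(\nabla\Gamma)\cap\Omega^k_{\mathcal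 I}$, $\Omega^k_{-,\mathcal I}=\ker\nabla\cap\Omega^k_{\mathcal I}$; $\mathcal B^{\pm,\mathcal I}_{\mathrm{even}}$ are the restrictions of $\mathcal B$ to the even-degree parts of these. The graded determinant is $\mathrm{Det}_{\mathrm{gr},\theta}(\mathcal B^{\mathcal I}_{\mathrm{even}})=\mathrm{Det}_\theta(\mathcal B^{+,\mathcal I}_{\mathrm{even}})/\mathrm{Det}_\theta(-\mathcal B^{-,\mathcal I}_{\mathrm{even}})$, where $\mathrm{Det}_\theta$ is the $\zeta$-regularized determinant $\exp(-\frac{d}{ds}|_{s=0}\mathrm{Tr}\,D_\theta^{-s})$ defined with the spectral cut along an Agmon angle $\theta\in(-\pi,0)$ (the result is independent of $\theta$). **$\eta$-invariant.** For an elliptic operator $D$ of order $m\geq 1$ with self-adjoint leading symbol, $\eta_\theta(s,D)=\mathrm{Tr}(\Pi_>D^s)-\mathrm{Tr}(\Pi_<(-D)^s)$ for $\mathrm{Re}\,s<-d/m$, continued meromorphically (regular at $0$), where $\Pi_>,\Pi_<$ are the spectral projections onto eigenvalues with positive, resp. negative, real part. Set $\eta(D)=\frac12(\eta_\theta(0,D)+m_+(D)-m_-(D)+m_0(D))$, with $m_\pm(D)$ the number (with algebraic multiplicity) of eigenvalues on the positive/negative imaginary axis and $m_0(D)$ the algebraic multiplicity of the eigenvalue $0$. $\eta(\nabla)=\eta(\mathcal B_{\mathrm{even}}(\nabla,g^M))$; $\eta_{\mathrm{trivial}}$ is the same invariant for the trivial line bundle $M\times\mathbb{C}$ with connection $d$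 and the same $g^M$. **Refined analytic torsion.** For any $\lambda\ge0$, the complex $\Omega^\bullet_{[0,\lambda]}(M,E)$ has cohomology canonically isomorphic to $H^\bullet(M,E)$; let $\rho_{\Gamma_{[0,\lambda]}}\in\mathrm{Det}(H^\bullet(M,E))$ be its refined torsion for $\Gamma|_{\Omega^\bullet_{[0,\lambda]}}$. Then $\rho_{\mathrm{an}}(\nabla)=\mathrm{Det}_{\mathrm{gr},\theta}(\mathcal B^{(\lambda,\infty)}_{\mathrm{even}})\cdot\rho_{\Gamma_{[0,\lambda]}}\cdot e^{i\pi\,\mathrm{rank}E\cdot\eta_{\mathrm{trivial}}}$, a non-zero element of $\mathrm{Det}(H^\bullet(M,E))$ independent of $\lambda$, $\theta$, $g^M$. The number $\eta(\nabla)-\mathrm{rank}E\cdot\eta_{\mathrm{trivial}}$ modulo $\mathbb{Z}$ is independent of $g^M$. *)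

(* Defs.v *)
From HB Require Import structures.
From mathcomp Require Import all_boot all_order all_fingroup all_algebra.
From mathcomp Require Import finmap complex.
From mathcomp Require Import all_classical all_reals all_analysis.

Set Implicit Arguments.
Unset Strict Implicit.
Unset Printing Implicit Defensive.

Import Order.TTheory GRing.Theory Num.Theory numFieldNormedType.Exports.

Local Open Scope classical_set_scope.
Local Open Scope complex_scope.
Local Open Scope ring_scope.

Section Smooth.
Variables (R : realType) (n : nat).

Definition partial (i : 'I_n) (f : 'rV[R]_n -> R) : 'rV[R]_n -> R :=
  fun y => 'D_(delta_mx 0 i) f y.

Fixpoint Ck (m : nat) (U : set 'rV[R]_n) (f : 'rV[R]_n -> R) : Prop :=
  (forall y, U y -> {for y, continuous f}) /\
  if m is m'.+1 then
    forall i, (forall y, U y -> derivable f y (delta_mx 0 i)) /\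
              Ck m' U (partial i f)
  else True.

Definition smooth U f := forall m, Ck m U f.

End Smooth.

Record closed_manifold (R : realType) (n : nat) := ClosedManifold {
  mcarrier :> topologicalType;
  chart_ix : Type;
  cdom : chart_ix -> set mcarrier;
  cmap : chart_ix -> mcarrier -> 'rV[R]_n;
  cinv : chart_ix -> 'rV[R]_n -> mcarrier;
  cdom_open : forall i, open (cdom i);
  cdom_cover : forall x, exists i, cdom i x;
  cimg_open : forall i, open (cmap i @` cdom i);
  cmapK : forall i x, cdom i x -> cinv i (cmap i x) = x;
  cmap_cont : forall i x, cdom i x -> {for x, continuous (cmap i)};
  cinv_cont : forall i y, (cmap i @` cdom i) y -> {for y, continuous (cinv i)};
  transition_smooth : forall i j a,
    smooth (cmap i @` (cdom i `&` cdom j)) (fun y => cmap j (cinv i y) 0 a);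
  m_hausdorff : hausdorff_space mcarrier;
  m_compact : compact [set: mcarrier]
}.

(* Vector fields are the derivations of C^oo(M).  They are represented by
   operators on all functions M -> R, with value 0 on non-smooth functions, so
   that two vector fields are equal as operators iff they are equal. *)
Section Fields.
Variables (R : realType) (n : nat) (M : closed_manifold R n).

Definition msmooth (U : set M) (f : M -> R) :=
  forall i, smooth (cmap i @` (cdom i `&` U)) (f \o cinv i).

Definition csmooth (U : set M) (f : M -> R[i]) :=
  msmooth U (fun x => complex.Re (f x)) /\ msmooth U (fun x => complex.Im (f x)).

Definition operator := (M -> R) -> (M -> R).

Definition vfield (X : operator) :=
  [/\ forall f, ~ msmooth setT f -> X f = 0,
      forall f, msmooth setT f -> msmooth setT (X f),
      forall (a : R) f h, msmooth setT f -> msmooth setT h ->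
        X (a *: (f : M -> R^o) + h) = a *: (X f : M -> R^o) + X h
    & forall f h, msmooth setT f -> msmooth setT h ->
        X (f * h) = f * X h + h * X f].

Definition vfields (Xs : seq operator) := forall X, X \in Xs -> vfield X.

Definition lie (X Y : operator) : operator := fun f => X (Y f) - Y (X f).

(* f X + Y *)
Definition vcomb (f : M -> R) (X Y : operator) : operator :=
  fun h => f * X h + Y h.

(* C^oo(M)-multilinear alternating maps on vector fields, in all degrees at
   once: the degree-k component of w is its restriction to lists of length k. *)
Definition alternating_form (V : zmodType) (scale : (M -> R) -> V -> V)
    (smoothV : V -> Prop) (w : seq operator -> V) :=
  [/\ forall Xs, ~ vfields Xs -> w Xs = 0,
      forall Xs, vfields Xs -> smoothV (w Xs),
      forall Xs Ys X Y f, vfields (Xs ++ X :: Y :: Ys) -> msmooth setT f ->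
        w (Xs ++ vcomb f X Y :: Ys) = scale f (w (Xs ++ X :: Ys)) + w (Xs ++ Y :: Ys)
    & forall Xs Ys Zs X, vfields (Xs ++ X :: Ys ++ Zs) ->
        w (Xs ++ X :: Ys ++ X :: Zs) = 0].

(* An orientation is given by a nowhere vanishing form of top degree. *)
Record orientation := Orientation {
  ovol : seq operator -> M -> R;
  ovol_form : alternating_form (fun f h : M -> R => f * h) (msmooth setT) ovol;
  ovol_top : forall Xs, size Xs != n -> ovol Xs = 0;
  ovol_neq0 : forall x, exists Xs, ovol Xs x != 0
}.

Record riemannian_metric := RiemannianMetric {
  gmet : operator -> operator -> M -> R;
  gmet_smooth : forall X Y, vfield X -> vfield Y -> msmooth setT (gmet X Y);
  gmet_sym : forall X Y, vfield X -> vfield Y -> gmet X Y = gmet Y X;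
  gmet_lin : forall f X Y Z, msmooth setT f ->
    vfield X -> vfield Y -> vfield Z ->
    gmet (vcomb f X Y) Z = f * gmet X Z + gmet Y Z;
  gmet_ge0 : forall X x, vfield X -> 0 <= gmet X X x;
  gmet_def : forall X x, vfield X -> gmet X X x = 0 -> forall f, X f x = 0
}.

Record vbundle (k : nat) := VBundle {
  fiber : M -> lmodType R[i];
  vb_ix : Type;
  vdom : vb_ix -> set M;
  frame : vb_ix -> 'I_k -> forall x, fiber x;
  vdom_open : forall i, open (vdom i);
  vdom_cover : forall x, exists i, vdom i x;
  frame_basis : forall i x, vdom i x -> forall v : fiber x,
    exists! c : 'rV[R[i]]_k, v = \sum_a c 0 a *: frame i a x;
  frame_smooth : forall i j b, exists c : 'I_k -> M -> R[i],
    (forall a, csmooth (vdom i `&` vdom j) (c a)) /\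
    forall x, vdom i x -> vdom j x ->
      frame j b x = \sum_a c a x *: frame i a x
}.

End Fields.

Definition sect (R : realType) (T : Type) (V : T -> lmodType R[i]) :=
  forall x, V x.

Section SectLmod.
Variables (R : realType) (T : Type) (V : T -> lmodType R[i]).
Local Notation S := (sect V).

HB.instance Definition _ := gen_eqMixin S.
HB.instance Definition _ := gen_choiceMixin S.

Let add (s t : S) : S := fun x => s x + t x.
Let opp (s : S) : S := fun x => - s x.
Let zero : S := fun x => 0.
Let scale (a : R[i]) (s : S) : S := fun x => a *: s x.

Let addA : associative add.
Proof. by move=> s t u; apply: functional_extensionality_dep => x; apply: addrA. Qed.
Let addC : commutative add.
Proof. by move=> s t; apply: functional_extensionality_dep => x; apply: addrC. Qed.
Let add0 : left_id zero add.
Proof. by move=> s; apply: functional_extensionality_dep => x; apply: add0r. Qed.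
Let addN : left_inverse zero opp add.
Proof. by move=> s; apply: functional_extensionality_dep => x; apply: addNr. Qed.

HB.instance Definition _ := GRing.isZmodule.Build S addA addC add0 addN.

Let scaleA a b s : scale a (scale b s) = scale (a * b) s.
Proof. by apply: functional_extensionality_dep => x; apply: scalerA. Qed.
Let scale1 : left_id 1 scale.
Proof. by move=> s; apply: functional_extensionality_dep => x; apply: scale1r. Qed.
Let scaleDr : right_distributive scale +%R.
Proof. by move=> a s t; apply: functional_extensionality_dep => x; apply: scalerDr. Qed.
Let scaleDl s : {morph scale^~ s : a b / a + b}.
Proof. by move=> a b; apply: functional_extensionality_dep => x; apply: scalerDl. Qed.

HB.instance Definition _ :=
  GRing.Zmodule_isLmodule.Build R[i] S scaleA scale1 scaleDr scaleDl.

End SectLmod.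

Section Connections.
Variables (R : realType) (n : nat) (M : closed_manifold R n).
Variables (k : nat) (E : vbundle M k).

Definition section := sect (fiber E).

Definition ssmooth (s : section) := forall i : vb_ix E,
  exists c : 'I_k -> M -> R[i],
  (forall a, csmooth (vdom i) (c a)) /\
  forall x, vdom i x -> s x = \sum_a c a x *: frame i a x.

Definition fscale (f : M -> R) (s : section) : section :=
  fun x => (f x)%:C *: s x.

(* The Leibniz rule for complex-valued functions follows from the one for
   real-valued functions and C-linearity. *)
Record flat_connection := FlatConnection {
  conn : operator M -> section -> section;
  conn_smooth : forall X s, vfield X -> ssmooth s -> ssmooth (conn X s);
  conn_lin : forall X (a : R[i]) s t, vfield X -> ssmooth s -> ssmooth t ->
    conn X (a *: s + t) = a *: conn X s + conn X t;
  conn_leibniz : forall X f s, vfield X -> msmooth setT f -> ssmooth s ->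
    conn X (fscale f s) = fscale (X f) s + fscale f (conn X s);
  conn_vlin : forall f X Y s, msmooth setT f -> vfield X -> vfield Y ->
    ssmooth s -> conn (vcomb f X Y) s = fscale f (conn X s) + conn Y s;
  conn_flat : forall X Y s, vfield X -> vfield Y -> ssmooth s ->
    conn X (conn Y s) - conn Y (conn X s) = conn (lie X Y) s
}.

Definition eform := seq (operator M) -> section.

Definition Omega : set eform := [set w | alternating_form fscale ssmooth w].

Definition Omega_deg (j : nat) : set eform :=
  [set w | Omega w /\ forall Xs, size Xs != j -> w Xs = 0].

Definition Omega_even : set eform :=
  [set w | Omega w /\ forall Xs, odd (size Xs) -> w Xs = 0].

Definition del (i : nat) (Xs : seq (operator M)) := take i Xs ++ drop i.+1 Xs.

Variable nabla : flat_connection.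

(* covariant differential, by Koszul's formula *)
Definition cov_diff (w : eform) : eform := fun Xs =>
  if `[< vfields Xs >] then
    \sum_(i < size Xs) (-1) ^+ i *: conn nabla (nth 0 Xs i) (w (del i Xs))
    + \sum_(j < size Xs) \sum_(i < j) (-1) ^+ (i + j) *:
        w (lie (nth 0 Xs i) (nth 0 Xs j) :: del i (del j Xs))
  else 0.

Definition cocycles (j : nat) : set eform :=
  [set w | Omega_deg j w /\ cov_diff w = 0].

Definition coboundaries (j : nat) : set eform :=
  if j is i.+1 then cov_diff @` Omega_deg i else [set 0].

Definition acyclic := forall j, cocycles j `<=` coboundaries j.

End Connections.

Arguments Omega {R n M k} E _.
Arguments Omega_deg {R n M k} E j _.
Arguments Omega_even {R n M k} E _.

Section SmoothLemmas.
Variables (R : realType) (n : nat).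
Implicit Types (U : set 'rV[R]_n) (f h : 'rV[R]_n -> R).

Lemma Ck_ext m U f h : open U -> (forall y, U y -> f y = h y) ->
  Ck m U f -> Ck m U h.
Proof.
move=> Uo; elim: m f h => [|m IH] f h fh [fc fD].
  split=> // y Uy.
  have e : {near y, f =1 h} by apply: filterS (open_nbhs_nbhs (conj Uo Uy)).
  have := cvg_trans (near_eq_cvg e) (fc y Uy).
  by move=> cc; rewrite (fh _ Uy) in cc; exact: cc.
have ne y : U y -> {near y, f =1 h}.
  by move=> Uy; apply: filterS (open_nbhs_nbhs (conj Uo Uy)).
split=> [y Uy|i].
  have := cvg_trans (near_eq_cvg (ne y Uy)) (fc y Uy).
  by move=> cc; rewrite (fh _ Uy) in cc; exact: cc.
have [fd fk] := fD i; split=> [y Uy|].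
  exact: near_eq_derivable (ne y Uy) (fd y Uy).
by apply: IH fk => y Uy; apply: near_eq_derive (ne y Uy).
Qed.

Lemma Ck_lin m U (a : R) f h : open U ->
  Ck m U f -> Ck m U h -> Ck m U (a \*: (f : _ -> R^o) + h).
Proof.
move=> Uo; elim: m f h => [|m IH] f h [fc fD] [hc hD].
  split=> // y Uy; apply: continuousD (hc y Uy).
  by apply: continuousM (fc y Uy); apply: cst_continuous.
split=> [y Uy|i].
  apply: continuousD (hc y Uy).
  by apply: continuousM (fc y Uy); apply: cst_continuous.
have [fd fk] := fD i; have [hd hk] := hD i; split=> [y Uy|].
  by apply: derivableD (hd y Uy); apply: derivableZ; apply: fd.
apply: Ck_ext (IH _ _ fk hk) => // y Uy.
rewrite /partial deriveD ?deriveZ //; [exact: fd|apply: derivableZ; exact: fd|exact: hd].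
Qed.

Lemma Ck_cst m U (a : R) : Ck m U (cst a).
Proof.
elim: m a => [|m IH] a; first by split=> // y _; apply: cst_continuous.
split=> [y _|i]; first exact: cst_continuous.
split=> [y _|]; first exact: derivable_cst.
suff -> : partial i (cst a) = cst 0 by [].
by apply/funext => y; apply: derive_cst.
Qed.

End SmoothLemmas.

Section TrivialBundle.
Variables (R : realType) (n : nat) (M : closed_manifold R n).

Lemma msmooth_lin (a : R) (f h : M -> R) : msmooth setT f -> msmooth setT h ->
  msmooth setT (a *: (f : M -> R^o) + h).
Proof.
move=> fs hs i m; apply: Ck_lin (fs i m) (hs i m).
by rewrite setIT; apply: cimg_open.
Qed.

Lemma msmooth_cst U (a : R) : msmooth U (fun _ : M => a).
Proof. by move=> i m; apply: Ck_cst. Qed.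

Lemma csmooth_cst U (a : R[i]) : csmooth U (fun _ : M => a).
Proof. by split; apply: msmooth_cst. Qed.

Let one_frame (_ : unit) (_ : 'I_1) (_ : M) : (R[i])^o := 1.

Let one_basis (i : unit) x : setT x -> forall v : (R[i])^o,
  exists! c : 'rV[R[i]]_1, v = \sum_a c 0 a *: one_frame i a x.
Proof.
move=> _ v; exists (const_mx v); split=> [|c ->].
  by rewrite big_ord1 mxE /one_frame /GRing.scale /= mulr1.
apply/rowP => j; rewrite mxE big_ord1 (ord1 j) /one_frame.
by rewrite /GRing.scale /= mulr1.
Qed.

Let one_smooth (i j : unit) (b : 'I_1) : exists c : 'I_1 -> M -> R[i],
  (forall a, csmooth (setT `&` setT) (c a)) /\
  forall x : M, setT x -> setT x ->
    one_frame j b x = \sum_a c a x *: one_frame i a x.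
Proof.
exists (fun _ _ => 1); split=> [a|x _ _]; first exact: csmooth_cst.
by rewrite big_ord1 scale1r.
Qed.

Definition trivial_bundle : vbundle M 1 :=
  @VBundle R n M 1 (fun=> (R[i])^o) unit (fun=> setT) one_frame
    (fun=> openT) (fun x => ex_intro _ tt I) one_basis one_smooth.

Local Notation S := (section trivial_bundle).

Let re (s : S) : M -> R := fun x => complex.Re (s x : R[i]).
Let im (s : S) : M -> R := fun x => complex.Im (s x : R[i]).

Definition trivial_conn (X : operator M) (s : S) : S :=
  fun x => (X (re s) x +i* X (im s) x : R[i]).

Let ssmoothP (s : S) :
  ssmooth s <-> msmooth setT (re s) /\ msmooth setT (im s).
Proof.
split=> [/(_ tt) [c [cs e]]|[sr si] i].
  have E : s = c 0.
    apply: functional_extensionality_dep => x.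
    by rewrite e // big_ord1 /= /one_frame /GRing.scale /= mulr1.
  by rewrite /re /im E; apply: (cs 0).
exists (fun _ => s); split=> [a|x _]; first by split.
by rewrite big_ord1 /= /one_frame /GRing.scale /= mulr1.
Qed.

Let sectP (s t : S) : re s = re t -> im s = im t -> s = t.
Proof.
move=> er ei; apply: functional_extensionality_dep => x.
move: (congr1 (@^~ x) er) (congr1 (@^~ x) ei); rewrite /re /im.
by case: (s x) => ? ?; case: (t x) => ? ? /= -> ->.
Qed.

Let conn_smooth0 X s : vfield X -> ssmooth s -> ssmooth (trivial_conn X s).
Proof. by move=> [_ Xs _ _] /ssmoothP[sr si]; apply/ssmoothP; split; apply: Xs. Qed.

Let re_lin (a : R[i]) (s t : S) : re (a *: s + t) =
  complex.Re a *: (re s : M -> R^o) + ((- complex.Im a) *: (im s : M -> R^o) + re t).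
Proof.
apply/funext => x; rewrite /re /im.
change (complex.Re (a * (s x : R[i]) + (t x : R[i])) =
  complex.Re a * complex.Re (s x) +
  (- complex.Im a * complex.Im (s x) + complex.Re (t x))).
by case: a (s x) (t x) => [ar ai] [sr si] [tr ti] /=; rewrite addrA mulNr.
Qed.

Let im_lin (a : R[i]) (s t : S) : im (a *: s + t) =
  complex.Re a *: (im s : M -> R^o) + (complex.Im a *: (re s : M -> R^o) + im t).
Proof.
apply/funext => x; rewrite /re /im.
change (complex.Im (a * (s x : R[i]) + (t x : R[i])) =
  complex.Re a * complex.Im (s x) +
  (complex.Im a * complex.Re (s x) + complex.Im (t x))).
by case: a (s x) (t x) => [ar ai] [sr si] [tr ti] /=; rewrite addrA.
Qed.

Let conn_lin0 X (a : R[i]) s t : vfield X -> ssmooth s -> ssmooth t ->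
  trivial_conn X (a *: s + t) = a *: trivial_conn X s + trivial_conn X t.
Proof.
move=> [_ _ Xl _] /ssmoothP[sr si] /ssmoothP[tr ti].
apply: sectP.
  transitivity (X (re (a *: s + t))) => //.
  by rewrite re_lin !Xl //; exact: msmooth_lin.
transitivity (X (im (a *: s + t))) => //.
by rewrite im_lin !Xl //; exact: msmooth_lin.
Qed.

Let re_fscale f (s : S) : re (fscale f s) = f * re s.
Proof.
apply/funext => x; rewrite /re /fscale /= /GRing.scale /= /GRing.mul /=.
by case: (s x) => sr si /=; rewrite mul0r subr0.
Qed.

Let im_fscale f (s : S) : im (fscale f s) = f * im s.
Proof.
apply/funext => x; rewrite /im /fscale /= /GRing.scale /= /GRing.mul /=.
by case: (s x) => sr si /=; rewrite mul0r addr0.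
Qed.

Let reD (s t : S) : re (s + t) = re s + re t.
Proof. by apply/funext => x; rewrite /re /GRing.add /=; case: (s x); case: (t x). Qed.
Let imD (s t : S) : im (s + t) = im s + im t.
Proof. by apply/funext => x; rewrite /im /GRing.add /=; case: (s x); case: (t x). Qed.
Let reN (s : S) : re (- s) = - re s.
Proof. by apply/funext => x; rewrite /re /GRing.opp /=; case: (s x). Qed.
Let imN (s : S) : im (- s) = - im s.
Proof. by apply/funext => x; rewrite /im /GRing.opp /=; case: (s x). Qed.

Let re_conn X s : re (trivial_conn X s) = X (re s). Proof. by []. Qed.
Let im_conn X s : im (trivial_conn X s) = X (im s). Proof. by []. Qed.

Let conn_leibniz0 X f s : vfield X -> msmooth setT f -> ssmooth s ->
  trivial_conn X (fscale f s) = fscale (X f) s + fscale f (trivial_conn X s).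
Proof.
move=> [_ _ _ Xm] fs /ssmoothP[sr si]; apply: sectP.
  by rewrite re_conn re_fscale Xm // reD !re_fscale re_conn addrC [re s * _]mulrC.
by rewrite im_conn im_fscale Xm // imD !im_fscale im_conn addrC [im s * _]mulrC.
Qed.

Let conn_vlin0 f X Y s : msmooth setT f -> vfield X -> vfield Y -> ssmooth s ->
  trivial_conn (vcomb f X Y) s = fscale f (trivial_conn X s) + trivial_conn Y s.
Proof.
move=> _ _ _ _; apply: sectP.
  by rewrite re_conn reD re_fscale !re_conn.
by rewrite im_conn imD im_fscale !im_conn.
Qed.

Let conn_flat0 X Y s : vfield X -> vfield Y -> ssmooth s ->
  trivial_conn X (trivial_conn Y s) - trivial_conn Y (trivial_conn X s) =
  trivial_conn (lie X Y) s.
Proof.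
move=> _ _ _; apply: sectP.
  by rewrite reD reN !re_conn.
by rewrite imD imN !im_conn.
Qed.

Definition trivial_connection : flat_connection trivial_bundle :=
  FlatConnection conn_smooth0 conn_lin0 conn_leibniz0 conn_vlin0 conn_flat0.

End TrivialBundle.

Section ComplexAnalysis.
Variable R : realType.
Local Notation C := R[i].

Definition cexp (z : C) : C :=
  (expR (complex.Re z))%:C * (cos (complex.Im z) +i* sin (complex.Im z)).

(* logarithm with cut along the ray of angle theta; junk on the ray and at 0 *)
Definition clog (theta : R) (mu : C) : C :=
  xget 0 [set l | cexp l = mu /\ theta < complex.Im l < theta + 2 * pi].

Definition meromorphic (F : C -> C) := forall p : C^o,
  exists (N : nat) (G : C^o -> C^o), \forall z \near p,
    derivable G z 1 /\ (z != p -> G z = (z - p) ^+ N * F z).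

Definition regular_at (p : C^o) (F : C^o -> C^o) :=
  \forall z \near p, derivable F z 1.

(* unordered sum over all complex numbers *)
Definition has_sum (a : C -> C) (S : C) := forall e : R, 0 < e ->
  exists F0 : {fset C}, forall F : {fset C}, (F0 `<=` F)%fset ->
    `|\sum_(mu <- F) a mu - S| < e%:C.

End ComplexAnalysis.

Section Spectrum.
Variables (R : realType) (V : lmodType R[i]).
Local Notation C := R[i].
Implicit Types (D : V -> V) (W : set V).

Definition root_space D W (mu : C) : set V :=
  [set w | W w /\ exists N, iter N (fun u => D u - mu *: u) w = 0].

Definition has_dim W (m : nat) := exists b : 'I_m -> V,
  [/\ forall i, W (b i),
      forall c : 'I_m -> C, \sum_i c i *: b i = 0 -> forall i, c i = 0
    & forall w, W w -> exists c : 'I_m -> C, w = \sum_i c i *: b i].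

(* algebraic multiplicity of mu as an eigenvalue of D on W *)
Definition mult D W (mu : C) : nat := xget 0%N (has_dim (root_space D W mu)).

(* no eigenvalue in a cone around the ray of angle theta *)
Definition agmon D W (theta : R) := exists2 e : R, 0 < e &
  forall phi rho : R, `|phi - theta| <= e -> 0 < rho ->
    root_space D W (rho%:C * cexp (0 +i* phi)) `<=` [set 0].

(* S is the trace of the power D_theta^s on the root spaces of the eigenvalues
   in P *)
Definition power_trace theta D W (P : set C) (s S : C) :=
  has_sum (fun mu => if `[< P mu >] then
                       (mult D W mu)%:R * cexp (s * clog theta mu) else 0) S.

(* n is the dimension of the manifold and D has order 1, so that the defining
   series converge for Re s > n, resp. Re s < - n *)
Variable n : nat.

Definition zeta_det theta D W : C := xget 0 [set c | exists F : C^o -> C^o,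
  [/\ meromorphic F, regular_at 0 F,
      forall s, n%:R < complex.Re s ->
        power_trace theta D W [set mu | mu != 0] (- s) (F s)
    & c = cexp (- 'D_1 F 0)]].

Definition eta_at0 theta D W : set C := [set e | exists F : C^o -> C^o,
  [/\ meromorphic F, regular_at 0 F,
      forall s, complex.Re s < - n%:R -> exists S1 S2,
        [/\ power_trace theta D W [set mu | 0 < complex.Re mu] s S1,
            power_trace theta (\- D) W [set mu | 0 < complex.Re mu] s S2
          & F s = S1 - S2]
    & e = F 0]].

Definition eta_invariant D W : C := xget 0 [set e | exists theta e0,
  [/\ - pi < theta < 0, agmon D W theta, agmon (\- D) W theta,
      eta_at0 theta D W e0
    & e = 2^-1 * (e0
        + \sum_(t \in [set t : R | 0 < t]) ((mult D W (0 +i* t))%:R : C)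
        - \sum_(t \in [set t : R | 0 < t]) ((mult D W (0 -i* t))%:R : C)
        + (mult D W 0)%:R)]].

End Spectrum.

Section DetLines.
Variables (R : realType) (V : lmodType R[i]).
Local Notation C := R[i].

Definition basis_mod (Z B : set V) (b : seq V) :=
  [/\ forall v, v \in b -> Z v,
      forall c : nat -> C, B (\sum_(i < size b) c i *: b`_i) ->
        forall i, (i < size b)%N -> c i = 0
    & forall z, Z z -> exists c : nat -> C, B (z - \sum_(i < size b) c i *: b`_i)].

Definition det_change (B : set V) (b b' : seq V) : C :=
  xget 1 [set z | exists P : 'M[C]_(size b), z = \det P /\
    forall i : 'I_(size b), B (b'`_i - \sum_(k < size b) P i k *: b`_k)].

Definition graded_basis (Z B : nat -> set V) (b : nat -> seq V) :=
  forall j, basis_mod (Z j) (B j) (b j).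

(* Det of the graded space with components Z j / B j, 0 <= j <= n.  An element
   is given by its coordinates: l b is its coefficient with respect to the
   generator that is the tensor product over j of the elements
   (b_j,1 ^ ... ^ b_j,m)^((-1)^j). *)
Definition Det (n : nat) (Z B : nat -> set V) : set ((nat -> seq V) -> C^o) :=
  [set l | (forall b, ~ graded_basis Z B b -> l b = 0) /\
    forall b b', graded_basis Z B b -> graded_basis Z B b' ->
      l b = l b' * \prod_(j < n.+1)
        (if odd j then (det_change (B j) (b j) (b' j))^-1
         else det_change (B j) (b j) (b' j))].

(* the canonical element 1 of Det(0) = C, and the identification Det(0) = C *)
Definition Det_one (Z B : nat -> set V) : (nat -> seq V) -> C^o :=
  fun b => if `[< graded_basis Z B b >] then 1 else 0.

Definition Det_val (l : (nat -> seq V) -> C^o) : C := l (fun=> [::]).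

Definition quadratic_form (L : set ((nat -> seq V) -> C^o))
    (tau : ((nat -> seq V) -> C^o) -> C) :=
  forall (z : C) h, L h -> tau (z *: h) = z ^+ 2 * tau h.

End DetLines.

Section RefinedTorsion.
Variables (R : realType) (V : lmodType R[i]) (r : nat).
Local Notation C := R[i].
Local Notation n := (r.*2.-1).
Variables (K : nat -> set V) (d Gamma : V -> V).
Let zero : nat -> set V := fun=> [set 0].

Definition sign_R (b : nat -> seq V) : nat :=
  (\sum_(j < r) size (b j) *
     (if odd (r + j) then (size (b j)).-1 else (size (b j)).+1))%N./2.

Definition c_Gamma : (nat -> seq V) -> C^o := xget 0 [set c |
  Det n K zero c /\ forall b, graded_basis K zero b ->
    (forall j, (j < r)%N -> b (n - j)%N = map Gamma (b j)) ->
    c b = (-1) ^+ sign_R b].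

Definition sign_N (x : nat -> seq V) : nat :=
  (\sum_(j < n.+1) size (x j) *
     (if odd j then (size (x j)).+1 else (size (x j)).-1))%N./2.

(* d x_(j-1) ^ h_j ^ x_j *)
Definition adapted (h x : nat -> seq V) (j : nat) : seq V :=
  (if j is i.+1 then map d (x i) else [::]) ++ h j ++ x j.

(* The cohomology of K is identified with that of a complex containing K by the
   inclusion, ZH j and BH j being the cocycles and coboundaries of the latter. *)
Variables ZH BH : nat -> set V.

Definition phi (l : (nat -> seq V) -> C^o) : (nat -> seq V) -> C^o :=
  xget 0 [set l' | Det n ZH BH l' /\ forall h x,
    graded_basis K zero (adapted h x) ->
    (forall j v, v \in h j -> d v = 0) ->
    l' h = (-1) ^+ sign_N x * l (adapted h x)].

Definition refined_torsion := phi c_Gamma.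

End RefinedTorsion.

Section RefinedAnalyticTorsion.
Variables (R : realType) (r : nat) (M : closed_manifold R r.*2.-1).
Local Notation C := R[i].
Local Notation n := (r.*2.-1).
Variables (o : orientation M) (g : riemannian_metric M).

Definition oriented_frame (x : M) (e : 'I_n -> operator M) :=
  [/\ forall i, vfield (e i),
      forall i j, gmet g (e i) (e j) x = (i == j)%:R
    & 0 < ovol o [seq e i | i <- enum 'I_n] x].

Section Bundle.
Variables (k : nat) (E : vbundle M k).

(* The Hodge star in all degrees at once: for an oriented frame e of T_xM and a
   permutation s,
   ( *w )(e_s(j+1), ..., e_s(n)) = sgn(s) w(e_s(1), ..., e_s(j)) at x. *)
Definition is_star (w v : eform E) := Omega E v /\
  forall x e (s : 'S_n) j, oriented_frame x e -> (j <= n)%N ->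
    v (drop j [seq e (s i) | i <- enum 'I_n]) x =
    (-1) ^+ s *: w (take j [seq e (s i) | i <- enum 'I_n]) x.

Definition star (w : eform E) : eform E := xget 0 (is_star w).

Definition chirality (w : eform E) : eform E := fun Xs =>
  let j := (n - size Xs)%N in
  ('i%C ^+ r * (-1) ^+ (j * j.+1)%N./2) *: star w Xs.

Variable nabla : flat_connection E.

Definition odd_signature (w : eform E) : eform E :=
  chirality (cov_diff nabla w) + cov_diff nabla (chirality w).

Definition eta_nabla : C := eta_invariant n odd_signature (Omega_even E).

Let Bsq := odd_signature \o odd_signature.

(* the images of the spectral projections of B^2 for [0, lam], i.e. the sum of
   the root spaces, and for ]lam, +oo[, i.e. the kernel of the former one *)
Definition Omega_le (lam : R) : set (eform E) := [set w |
  exists (m : nat) (nu : 'I_m -> C) (v : 'I_m -> eform E),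
    (forall i, `|nu i| <= lam%:C /\ root_space Bsq (Omega E) (nu i) (v i))
    /\ w = \sum_i v i].

Definition Omega_gt (lam : R) : set (eform E) := [set w | Omega E w /\
  forall nu : C, `|nu| <= lam%:C -> forall N, exists2 u, Omega E u &
    w = iter N (fun v => Bsq v - nu *: v) u].

Definition Omega_even_plus (lam : R) : set (eform E) :=
  [set w | [/\ Omega_gt lam w, Omega_even E w & cov_diff nabla (chirality w) = 0]].

Definition Omega_even_minus (lam : R) : set (eform E) :=
  [set w | [/\ Omega_gt lam w, Omega_even E w & cov_diff nabla w = 0]].

Definition agmon_gr (lam theta : R) :=
  agmon odd_signature (Omega_even_plus lam) theta /\
  agmon (\- odd_signature) (Omega_even_minus lam) theta.

Definition Det_gr (lam theta : R) : C :=
  zeta_det n theta odd_signature (Omega_even_plus lam) /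
  zeta_det n theta (\- odd_signature) (Omega_even_minus lam).

Definition DetH := Det n (cocycles nabla) (coboundaries nabla).

Definition rho_Gamma (lam : R) : (nat -> seq (eform E)) -> C^o :=
  refined_torsion r (fun j => Omega_le lam `&` Omega_deg E j)
    (cov_diff nabla) chirality (cocycles nabla) (coboundaries nabla).

End Bundle.

Definition eta_trivial : C := eta_nabla (trivial_connection M).

Definition rho_an (k : nat) (E : vbundle M k) (nabla : flat_connection E)
    (lam theta : R) : (nat -> seq (eform E)) -> C^o :=
  (Det_gr nabla lam theta * cexp ('i%C * pi%:C * k%:R * eta_trivial))
    *: rho_Gamma nabla lam.

End RefinedAnalyticTorsion.

(* Main.v *)
(** The quadratic form takes the value [exp (...) <> 0] at [rho_an], hence
    [rho_an], an element of the line [Det (H)], is not zero; this spares the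
    proof that the graded determinant and the refined torsion do not vanish.
    When [H = 0] the only graded basis is the empty one, so
    [1 = rho^-1 *: rho_an], and [tau] can be evaluated by homogeneity. *)

Require Import Defs.
From mathcomp Require Import all_boot all_order all_fingroup all_algebra.
From mathcomp Require Import finmap complex ring.
From mathcomp Require Import all_classical all_reals all_analysis.

Import Order.TTheory GRing.Theory Num.Theory numFieldNormedType.Exports.

Local Open Scope classical_set_scope.
Local Open Scope complex_scope.
Local Open Scope ring_scope.

Section ComplexExponential.
Variable R : realType.
Implicit Types z w : R[i].

Lemma cexpD z w : cexp (z + w) = cexp z * cexp w.
Proof.
case: z w => [a b] [c d]; rewrite /cexp /= expRD cosD sinD.
by apply/eqP; rewrite eq_complex /=; apply/andP; split; apply/eqP; ring.
Qed.

Lemma cexp0 : cexp (0 : R[i]) = 1.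
Proof. by rewrite /cexp /= expR0 cos0 sin0 mul1r. Qed.

Lemma cexp_neq0 z : cexp z != 0.
Proof.
apply/eqP => e0; have := cexpD z (- z).
by rewrite subrr cexp0 e0 mul0r => /eqP; rewrite oner_eq0.
Qed.

Lemma cexpN z : cexp (- z) = (cexp z)^-1.
Proof.
apply: (mulfI (cexp_neq0 z)).
by rewrite -cexpD subrr cexp0 divff ?cexp_neq0.
Qed.

End ComplexExponential.

Section DeterminantLine.
Variables (R : realType) (V : lmodType R[i]).
Implicit Types (Z B : nat -> set V) (l : (nat -> seq V) -> R[i]^o).

Lemma DetZ n Z B (a : R[i]) l : Det n Z B l -> Det n Z B (a *: l).
Proof.
move=> [l0 lE]; split=> [b /l0 e|b b' hb hb'].
  by rewrite [LHS](_ : _ = a * l b) // e mulr0.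
by rewrite [LHS](_ : _ = a * l b) // (lE _ _ hb hb') mulrA.
Qed.

Lemma Det0 n Z B : Det n Z B 0.
Proof. by split=> // b b' _ _; rewrite mul0r. Qed.

(** The element chosen by [xget] lies in the line by its defining property, and the default value 0
    lies there by [Det0]. *)
Lemma phi_Det (r : nat) K (d : V -> V) Z B l :
  Det r.*2.-1 Z B (phi r K d Z B l).
Proof.
rewrite /phi; case: xgetP => [l' _ []//|_]; exact: Det0.
Qed.

Variables (Z B : nat -> set V) (ZB : forall j, Z j `<=` B j).

(** A vector of [b j] lies in [Z j], hence in [B j], which contradicts freeness modulo [B j].
    Conversely, the empty family spans because [Z j] is zero modulo [B j]. *)
Lemma graded_basis_acyclic b : graded_basis Z B b <-> b = (fun=> [::]).
Proof.
split=> [hb|-> j]; last first.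
  split=> // z /ZB Bz; exists (fun=> 0).
  by rewrite big_ord0 subr0.
apply/funext => j; have [bZ bfree _] := hb j.
case E: (b j) => [//|v s]; rewrite E in bZ bfree.
(* The coefficients 1, 0, 0, ... single out [v]; as [v] is in [B j], freeness will force 1 = 0. *)
have sumE : \sum_(i < size (v :: s)) (i == 0%N :> nat)%:R *: (v :: s)`_i = v.
  by rewrite big_ord_recl /= scale1r big1 ?addr0 // => i _; rewrite scale0r.
have Bv : B j v by apply: ZB; apply: bZ; exact: mem_head.
rewrite -sumE in Bv.
by have /eqP := bfree (fun i => (i == 0%N)%:R) Bv 0%N isT; rewrite oner_eq0.
Qed.

(** Both sides vanish off graded bases, and at the empty one, the only graded basis, [Det_one] is
    1. *)
Lemma Det_acyclic n l : Det n Z B l -> l = Det_val l *: Det_one Z B.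
Proof.
move=> [l0 _]; apply/funext => b.
rewrite [RHS](_ : _ = Det_val l * Det_one Z B b) // /Det_one.
case: asboolP => [/graded_basis_acyclic ->|/l0 ->]; last by rewrite mulr0.
by rewrite mulr1.
Qed.

End DeterminantLine.

Theorem corollary1p7 (R : realType) (r : nat) (r_gt0 : (0 < r)%N)
    (M : closed_manifold R r.*2.-1) (o : orientation M)
    (k : nat) (E : vbundle M k) (nabla : flat_connection E)
    (g : riemannian_metric M) (lam theta : R)
    (lam_ge0 : 0 <= lam) (theta_bounds : - pi < theta < 0)
    (theta_agmon : agmon_gr o g nabla lam theta)
    (tau : ((nat -> seq (eform E)) -> R[i]^o) -> R[i])
    (tau_quadratic : quadratic_form (DetH nabla) tau)
    (tau_rho : tau (rho_an o g nabla lam theta) =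
       cexp (- (2 * 'i%C * pi%:C * (eta_nabla o g nabla - k%:R * eta_trivial o g))))
    (acyclicE : acyclic nabla) :
  let rho := Det_val (rho_an o g nabla lam theta) in
  let tau1 := tau (Det_one (cocycles nabla) (coboundaries nabla)) in
  [/\ rho != 0, tau1 != 0 &
      tau1 = (rho * cexp ('i%C * pi%:C * (eta_nabla o g nabla - k%:R * eta_trivial o g))) ^- 2].
Proof.
move=> rho tau1.
set X := 'i%C * pi%:C * _.
have rhoL : DetH nabla (rho_an o g nabla lam theta).
  by apply: DetZ; apply: phi_Det.
have rhoE := Det_acyclic _ _ _ _ acyclicE _ _ rhoL.
have tau_rhoX : tau (rho_an o g nabla lam theta) = cexp X ^- 2.
  (* The factor 2 in the exponent becomes the square. *)
  rewrite tau_rho [X in cexp (- X)](_ : _ = X + X).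
    by rewrite cexpN cexpD -expr2.
  by rewrite /X; ring.
have rho_neq0 : rho != 0.
  (* If [rho] were 0, [rho_an] would equal [0 *: rho_an], so homogeneity would make its [tau]-value
     0, whereas [cexp X ^- 2] is not. *)
  apply/eqP => rho0; have := tau_quadratic 0 _ rhoL.
  have <- : rho_an o g nabla lam theta = 0 *: rho_an o g nabla lam theta.
    by rewrite [LHS]rhoE -/rho rho0 !scale0r.
  rewrite tau_rhoX expr0n mul0r => /eqP.
  by rewrite invr_eq0 expf_eq0 (negPf (cexp_neq0 _ _)).
have tau1E : tau1 = (rho * cexp X) ^- 2.
  (* Writing 1 as [rho^-1 * rho] and using [rhoE] backwards turns [Det_one] into
     [rho^-1 *: rho_an]. *)
  rewrite /tau1 -[Det_one _ _]scale1r -(mulVf rho_neq0) -scalerA -rhoE.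
  by rewrite (tau_quadratic _ _ rhoL) tau_rhoX exprVn -invfM -exprMn.
split=> //; rewrite tau1E invr_eq0 expf_eq0 /=.
by rewrite mulf_neq0 ?cexp_neq0.
Qed.
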